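(* Let $\pi\in\mathfrak{S}_n$, let $\Pi$ be the valley-hopping orbit of $\pi$, $\hat\Pi$ the restricted valley-hopping orbit of $\pi$, $\Pi'$ the cyclic valley-hopping orbit of $\Phi(\pi)$, and $\hat\Pi'$ the restricted cyclic valley-hopping orbit of $\Phi(\pi)$. Then (a) $\Phi(\Pi)=\Pi'$ and (b) $\Phi(\hat\Pi)=\hat\Pi'$.
   Context: Permutations $\pi=\pi_1\cdots\pi_n\in\mathfrak{S}_n$ are written in one-line notation, with convention $\pi_0=\pi_{n+1}=\infty$. A letter $\pi_i$ is a descent if $\pi_i>\pi_{i+1}$, an ascent if $\pi_i<\pi_{i+1}$; a peak if $\pi_{i-1}<\pi_i>\pi_{i+1}$, a valley if $\pi_{i-1}>\pi_i<\pi_{i+1}$, a double ascent if $\pi_{i-1}<\pi_i<\pi_{i+1}$, a double descent if $\pi_{i-1}>\pi_i>\pi_{i+1}$. Rix-factorization: $\pi=\alpha_1\cdots\alpha_k\beta$ is obtained by: (1) $w:=\pi$, $i:=0$; (2) if $w$ is increasing, $\beta:=w$, stop; else $i:=i+1$, let $x$ be the largest descent of the word $w$, write $w=w'xw''$; (3) if $w'$ is empty, $\beta:=w$, stop; else $\alpha_i:=w'x$, $w:=w''$, go to (2). $\beta_1(\pi)$ is the first letter of $\beta$. A rixed point of $\pi$ is a letter of the maximal increasing suffix of $\pi$ not smaller than $\beta_1(\pi)$; $\mathrm{Rix}(\pi)$ is their set (it is the set of letters of a suffix $\pi_j\cdots\pi_n$ of $\pi$, contained in $\beta$). Lin–Zeng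 bijection $\Phi:\mathfrak{S}_n\to\mathfrak{S}_n$: with $\mathrm{Rix}(\pi)=\{\pi_j,\dots,\pi_n\}$, let $\delta$ be defined by $\beta=\delta\pi_j\cdots\pi_n$. If $\delta=d_1\cdots d_l$ is nonempty let $\tilde\delta=(d_1,d_l,d_{l-1},\dots,d_2)$ (a cycle; absent if $\delta$ empty); for $\alpha_i=a_1\cdots a_l$ let $\tilde\alpha_i=(a_l,a_{l-1},\dots,a_1)$. Then $\Phi(\pi)=\tilde\alpha_1\cdots\tilde\alpha_k\tilde\delta(\pi_j)(\pi_{j+1})\cdots(\pi_n)$ in cycle notation. Valley-hopping: for $x\in[n]$ write $\pi=w_1w_2xw_4w_5$ with $w_2$ (resp. $w_4$) the maximal consecutive subword immediately left (resp. right) of $x$ with all letters smaller than $x$; $\varphi_x(\pi)=w_1w_4xw_2w_5$ if $x$ is a double ascent or double descent, $\varphi_x(\pi)=\pi$ if $x$ is a peak or valley. These commute; $\varphi_S=\prod_{x\in S}\varphi_x$; the valley-hopping orbit of $\pi$ is $\{\varphi_S(\pi):S\subseteq[n]\}$. Canonical cycle representation: each cycle is written with its largest element first, cycles listed in increasing order of largest elements. Foata's fundamental transformation $o:\mathfrak{S}_n\to\mathfrak{S}_n$ writes $\pi$ in canonical cycle representation and erases the parentheses, reading the result as a one-line permutation. $\psi_x=o^{-1}\circ\varphi_x\circ o$, $\psi_S=\prod_{x\in S}\psi_x$; the cyclic valley-hopping orbit of $\tau$ is $\{\psi_S(\tau):S\subseteq[n]\}$. Restricted versions: $\hat\varphi_x(\pi)=\pi$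 if $x\in\mathrm{Rix}(\pi)$ or $x=\beta_1(\pi)$, and $\hat\varphi_x(\pi)=\varphi_x(\pi)$ otherwise; $\hat\varphi_S=\prod_{x\in S}\hat\varphi_x$, and the restricted valley-hopping orbit of $\pi$ is $\{\hat\varphi_S(\pi):S\subseteq[n]\}$. $\hat\psi_x(\tau)=\tau$ if $x$ is a fixed point of $\tau$ or $x$ is the first letter of $o(\tau)$, and $\hat\psi_x(\tau)=\psi_x(\tau)$ otherwise; $\hat\psi_S=\prod_{x\in S}\hat\psi_x$, and the restricted cyclic valley-hopping orbit of $\tau$ is $\{\hat\psi_S(\tau):S\subseteq[n]\}$. *)

(* Defs.v *)
From mathcomp Require Import all_boot all_fingroup.

Set Implicit Arguments.
Unset Strict Implicit.
Unset Printing Implicit Defensive.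

(* The letters 1, ..., n are renumbered 0, ..., n-1, i.e., they are the         *)
(* elements of 'I_n, ordered as natural numbers. The value n is larger than all *)
(* letters and plays the role of the letter at infinity.                        *)

Section Words.

Variable n : nat.
Implicit Types (w s : seq 'I_n) (x : 'I_n) (p : 'S_n).

Definition word p : seq 'I_n := codom p.

(* The permutation with one-line notation w. When w is not a rearrangement of   *)
(* enum 'I_n this is a junk value.                                              *)
Definition of_word w : 'S_n := insubd (1%g : 'S_n) [ffun i : 'I_n => nth i w i].


Lemma of_wordK w : perm_eq w (enum 'I_n) -> word (of_word w) = w.
Proof.
move=> w_perm.
have sw : size w = n by rewrite (perm_size w_perm) size_enum_ord.
have uw : uniq w by rewrite (perm_uniq w_perm) enum_uniq.
have ofE (i : 'I_n) : of_word w i = nth i w i.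
  rewrite -pvalE /of_word insubdK ?ffunE //=.
  apply/injectiveP => j k; rewrite !ffunE (set_nth_default j k) ?sw //.
  by move/eqP; rewrite nth_uniq ?sw // => /eqP/val_inj.
rewrite /word codomE (eq_map ofE).
case: w sw {w_perm uw ofE} => [|i0 w] sw.
  by apply/nilP; rewrite /nilp size_map size_enum_ord -sw.
apply: (@eq_from_nth _ i0) => [|i]; rewrite size_map size_enum_ord // => lin.
rewrite (nth_map i0) ?size_enum_ord // nth_enum_ord //.
by apply: set_nth_default; rewrite sw.
Qed.

(* The first letter of w (n if w is empty). *)
Definition first w : nat := head n (map val w).

(* The letters immediately to the left and right of x in the word w, which is   *)
(* bordered by letters at infinity.                                             *)
Definition lnbr w x : nat := nth n (n :: map val w) (index x w).
Definition rnbr w x : nat := nth n (map val w) (index x w).+1.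

Definition descent w x := rnbr w x < x.
Definition double_ascent w x := lnbr w x < x < rnbr w x.
Definition double_descent w x := rnbr w x < x < lnbr w x.

Definition increasing w := sorted (fun x y : 'I_n => x < y) w.

Definition largest_descent w x :=
  descent w x && all (fun y => descent w y ==> (y <= x)) w.

(* The first argument of rix_rec is fuel: every step shortens the word, so      *)
(* size w suffices.                                                             *)
Fixpoint rix_rec (m : nat) w : seq (seq 'I_n) * seq 'I_n :=
  if m is m'.+1 then
    let i := find (largest_descent w) w in
    if increasing w || (i == 0) then ([::], w)
    else let: (alphas, beta) := rix_rec m' (drop i.+1 w) in
         (take i.+1 w :: alphas, beta)
  else ([::], w).

(* ([:: alpha_1; ...; alpha_k], beta) *)
Definition rix_fact w := rix_rec (size w) w.

Definition beta1 w : nat := first (rix_fact w).2.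

Fixpoint incr_suffix w : seq 'I_n :=
  if w is _ :: w' then if increasing w then w else incr_suffix w' else [::].

Definition Rix w : seq 'I_n := [seq x : 'I_n <- incr_suffix w | beta1 w <= x].

Definition Phi_cycles w : seq (seq 'I_n) :=
  let: (alphas, beta) := rix_fact w in
  let delta := take (size beta - size (Rix w)) beta in
  [seq rev a | a <- alphas]
    ++ (if delta is d :: ds then [:: d :: rev ds] else [::])
    ++ [seq [:: x] | x <- Rix w].

(* The cycle c_1 -> c_2 -> ... -> c_l -> c_1. The cycles used below have no     *)
(* repeated letter, so undup only serves to make the definition total.          *)
Definition cycle_perm (c : seq 'I_n) : 'S_n :=
  perm (can_inj (prev_next (undup_uniq c))).

Definition Phi p : 'S_n := (\prod_(c <- Phi_cycles (word p)) cycle_perm c)%g.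

(* The longest prefix of s with all letters smaller than x, and the rest. *)
Definition split_lt x s : seq 'I_n * seq 'I_n :=
  let i := find (fun y : 'I_n => x <= y) s in (take i s, drop i s).

Definition hop_word x w : seq 'I_n :=
  if double_ascent w x || double_descent w x then
    let i := index x w in
    let: (w2r, w1r) := split_lt x (rev (take i w)) in
    let: (w4, w5) := split_lt x (drop i.+1 w) in
    rev w1r ++ w4 ++ x :: rev w2r ++ w5
  else w.

Definition hop x p : 'S_n := of_word (hop_word x (word p)).

(* The cycle of p containing x, started at x, is fingraph.orbit p x. *)
Definition canonical_cycles p : seq (seq 'I_n) :=
  [seq fingraph.orbit p x
  | x <- enum 'I_n & all (fun y : 'I_n => y <= x) (fingraph.orbit p x)].

Definition foata p : 'S_n := of_word (flatten (canonical_cycles p)).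

(* finv is the inverse of an injective self-map of a finite type; foata is such *)
(* a map, since the cycles start at the left-to-right maxima of the word.       *)
Definition cyclic_hop x p : 'S_n := finv foata (hop x (foata p)).

Definition restricted_hop x p : 'S_n :=
  if (x \in Rix (word p)) || (val x == beta1 (word p)) then p else hop x p.

Definition restricted_cyclic_hop x p : 'S_n :=
  if (p x == x) || (val x == first (word (foata p))) then p else cyclic_hop x p.

(* The composite of the maps f x for x in S; it is only used for commuting      *)
(* families f, for which the order of composition is irrelevant.                *)
Definition comp_set (f : 'I_n -> 'S_n -> 'S_n) (S : {set 'I_n}) p : 'S_n :=
  foldr f p (enum S).

Definition hop_orbit (f : 'I_n -> 'S_n -> 'S_n) p : {set 'S_n} :=
  [set comp_set f S p | S : {set 'I_n}].

End Words.

(* Main.v *)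
(* Cut a word at its maximum, w = L m R. Hopping at m exchanges L and R when one *)
(* of them is empty and does nothing otherwise, and hopping at another letter    *)
(* acts inside L or R; hence hopping at a set of letters is an action of the     *)
(* group of sets under symmetric difference, and it commutes with reversal. Call *)
(* locked the letters of Rix(w) together with beta_1(w). The recursions          *)
(*   theta(m R) = m rev(R),  theta(L m) = theta(L) m,                            *)
(*   theta(L m R) = theta(R) m rev(L)  for L, R nonempty,                        *)
(* satisfied by theta = foata o Phi, show that theta(w) is rev(w) hopped at the  *)
(* locked letters of w. This gives theta(Pi) \subset orbit of theta(w). On the   *)
(* cyclic side the locked letters (the fixed points and the first letter) obey   *)
(* the mirror-image recursion; theta preserves locked letters, so it has the     *)
(* analogous map as its inverse, which gives (a). Hops at unlocked letters do    *)
(* not change the locked letters, so theta commutes with them: this is (b).      *)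

Require Import Defs.
From mathcomp Require Import all_boot all_fingroup zify.

Set Implicit Arguments.
Unset Strict Implicit.
Unset Printing Implicit Defensive.

Section Hopping.
Variable n : nat.
Implicit Types (w s L R : seq 'I_n) (x y m : 'I_n) (p q : 'S_n) (S T : {set 'I_n}).

(** Through [foata], cyclic hopping becomes ordinary hopping of words ([foata_cyclic_hop]), so
    everything reduces to the map theta = foata o Phi on words. Let m be the maximum of w = L m R.
    If both sides are nonempty, L m is the first factor and yields the cycle (m, rev L), which comes
    last in canonical order; a leading m makes the whole word one cycle; a trailing m is one more
    fixed point. This is the recursion of [lock_rev rix_locked] ([canonical_Phi_cycles],
    [word_foata_Phi]). Part (a) then follows from the group action ([flip_flip], [rev_flip]) and the
    inverse of theta ([lock_revK]), part (b) from [lock_rev_locking] and [lock_rev_flip]. *)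

Definition below m L := all (fun y : 'I_n => y < m) L.

(** This is induction along the decreasing binary tree of a word: the root is the maximum, the
    subtrees are the two sides. Hops, reversal, locked letters and cycles are all computed node by
    node on this tree. *)
Lemma max_word_ind (P : seq 'I_n -> Prop) :
  P [::] ->
  (forall L m R, uniq (L ++ m :: R) -> below m L -> below m R ->
     P L -> P R -> P (L ++ m :: R)) ->
  forall w, uniq w -> P w.
Proof.
move=> P0 Pnode w; have [k] := ubnP (size w).
elim: k w => // k IHk w ltwk uw; case: w => [//|x0 w] in ltwk uw *.
set w0 := x0 :: w in ltwk uw *.
have [m mw m_max] : exists2 m, m \in w0 & {in w0, forall y, y <= m}.
  have x0w : x0 \in w0 by rewrite mem_head.
  by case: (@arg_maxnP _ x0 (mem w0) val x0w) => m mw m_max; exists m.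
case/splitPr: w0 / mw => L R in ltwk uw m_max *.
have [uL mL] : uniq L /\ m \notin L.
  by move: uw; rewrite cat_uniq /= negb_or => /and3P[-> /andP[]].
have [uR mR] : uniq R /\ m \notin R.
  by move: uw; rewrite cat_uniq /= => /and4P[].
rewrite size_cat /= in ltwk.
have lt_m z : z \in L ++ m :: R -> z != m -> z < m.
  by move=> zw zm; rewrite ltn_neqAle m_max // andbT.
apply: Pnode => //.
- apply/allP=> y yL; apply: lt_m; first by rewrite mem_cat yL.
  by apply: contraNneq mL => <-.
- apply/allP=> y yR; apply: lt_m; first by rewrite mem_cat inE yR !orbT.
  by apply: contraNneq mR => <-.
- by apply: IHk => //; lia.
- by apply: IHk => //; lia.
Qed.

(** * Hopping at one letter of a word cut at its maximum *)

Lemma rnbr_cat L x R : x \notin L -> rnbr (L ++ x :: R) x = first R.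
Proof.
move=> xL; rewrite /rnbr index_pivot // map_cat nth_cat size_map ltnNge leqnSn /=.
by rewrite subSnn; case: R.
Qed.

Lemma lnbr_cat L x R : x \notin L -> lnbr (L ++ x :: R) x = last n (map val L).
Proof.
move=> xL; rewrite /lnbr index_pivot // map_cat -cat_cons nth_cat /= size_map ltnSn.
by rewrite (last_nth n) size_map.
Qed.

Lemma hop_word_cat L x R : x \notin L ->
  hop_word x (L ++ x :: R) =
  let: (w2r, w1r) := split_lt x (rev L) in
  let: (w4, w5) := split_lt x R in
  if (last n (map val L) < x < first R) || (first R < x < last n (map val L))
  then rev w1r ++ w4 ++ x :: rev w2r ++ w5 else L ++ x :: R.
Proof.
move=> xL; rewrite /hop_word /double_ascent /double_descent rnbr_cat // lnbr_cat //.
rewrite index_pivot // take_size_cat //.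
by rewrite -cat_rcons drop_size_cat ?size_rcons //; do 2 case: split_lt => ? ?.
Qed.

Lemma split_lt_cat x s m s' : x < m ->
  split_lt x (s ++ m :: s') = let: (a, b) := split_lt x s in (a, b ++ m :: s').
Proof.
move=> xm; rewrite /split_lt find_cat; case: ifPn => [hs|].
  by move: hs; rewrite has_find => hs; rewrite take_cat drop_cat hs.
move=> hs; rewrite /= (ltnW xm) addn0 take_size_cat // drop_size_cat //.
by rewrite hasNfind // take_size drop_size.
Qed.

Lemma split_lt_below x s : below x s -> split_lt x s = (s, [::]).
Proof.
move=> xs; rewrite /split_lt hasNfind ?take_size ?drop_size //.
by apply/hasPn=> y ys /=; rewrite -ltnNge (allP xs).
Qed.

(** The value [n] read off an empty word is the letter at infinity, so comparing the maximum with
    its neighbours only tests which sides are empty. *)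
Lemma last_below m L : below m L -> (last n (map val L) < m) = ~~ nilp L.
Proof.
case/lastP: L => [_|L x]; first by rewrite /= ltnNge ltnW.
by rewrite /below all_rcons /nilp size_rcons map_rcons last_rcons /= => /andP[->].
Qed.

Lemma first_below m L : below m L -> (first L < m) = ~~ nilp L.
Proof.
case: L => [_|x L]; first by rewrite /first /= ltnNge ltnW.
by rewrite /first /= => /andP[->].
Qed.

Lemma lt_last_below m L : below m L -> (m < last n (map val L)) = nilp L.
Proof.
move=> bL; case: (boolP (nilp L)) => [/nilP-> | nL]; first exact: ltn_ord.
by apply/negbTE; rewrite -leqNgt ltnW // last_below.
Qed.

Lemma lt_first_below m L : below m L -> (m < first L) = nilp L.
Proof.
move=> bL; case: (boolP (nilp L)) => [/nilP-> | nL]; first exact: ltn_ord.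
by apply/negbTE; rewrite -leqNgt ltnW // first_below.
Qed.

Lemma below_rev m L : below m (rev L) = below m L. Proof. exact: all_rev. Qed.

(** The blocks next to the maximum are all of [L] and all of [R], and [m] is a peak exactly when
    both are nonempty. When both are empty it is a valley, and the exchange is vacuous. *)
Lemma hop_word_max L m R : below m L -> below m R ->
  hop_word m (L ++ m :: R) = if nilp L || nilp R then R ++ m :: L else L ++ m :: R.
Proof.
move=> bL bR; have mL : m \notin L.
  by apply/negP=> /(allP bL); rewrite ltnn.
rewrite hop_word_cat // !split_lt_below ?below_rev // revK cats0 /=.
rewrite last_below // first_below // lt_last_below // lt_first_below //.
by case: nilP => [->|_]; case: nilP => [->|_].
Qed.

(** Seen from [x < m], the letter [m] behaves like the border at infinity: it stops the block of
    smaller letters and compares with [x] in the same way. *)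
Lemma hop_word_left x L m R : x \in L -> uniq (L ++ m :: R) -> x < m ->
  hop_word x (L ++ m :: R) = hop_word x L ++ m :: R.
Proof.
move=> xL; case/splitPr: L / xL => A B; rewrite -!catA /= => uw xm.
have xA : x \notin A by move: uw; rewrite cat_uniq /= negb_or => /and3P[_ /andP[]].
rewrite !hop_word_cat // split_lt_cat //.
case: (split_lt x (rev A)) => a b; case: (split_lt x B) => c d.
have -> : (x < first (B ++ m :: R)) = (x < first B).
  by case: B {uw} => [|z B] //=; rewrite /first /= ltn_ord.
have -> : (first (B ++ m :: R) < x) = (first B < x).
  case: B {uw} => [|z B] //=; rewrite /first /= !ltnNge.
  by rewrite ltnW // ltnW.
by case: ifP => _; rewrite -?catA //= -?catA.
Qed.

Lemma hop_word_right x L m R : x \in R -> uniq (L ++ m :: R) -> x < m ->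
  hop_word x (L ++ m :: R) = L ++ m :: hop_word x R.
Proof.
move=> xR; case/splitPr: R / xR => A B; rewrite -cat_cons catA => uw xm.
have xA : x \notin L ++ m :: A.
  by move: uw; rewrite cat_uniq /= negb_or => /and3P[_ /andP[]].
have xA' : x \notin A by move: xA; rewrite mem_cat inE !negb_or => /and3P[].
rewrite !hop_word_cat // rev_cat rev_cons cat_rcons split_lt_cat //.
case: (split_lt x (rev A)) => a b; case: (split_lt x B) => c d.
have -> : (x < last n (map val (L ++ m :: A))) = (x < last n (map val A)).
  rewrite map_cat last_cat /=; case: A {uw xA xA'} => [|z A] //=.
  by rewrite xm ltn_ord.
have -> : (last n (map val (L ++ m :: A)) < x) = (last n (map val A) < x).
  rewrite map_cat last_cat /=; case: A {uw xA xA'} => [|z A] //=.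
  by rewrite !ltnNge ltnW // ltnW.
case: ifP => _; last by rewrite -catA.
by rewrite rev_cat rev_cons revK -cats1 -!catA.
Qed.

(* Off the letters of w, hop_word is a junk value. *)
Definition hop_in x w := if x \in w then hop_word x w else w.

Lemma hop_in_node x L m R : uniq (L ++ m :: R) -> below m L -> below m R ->
  hop_in x (L ++ m :: R) =
  if x == m then if nilp L || nilp R then R ++ m :: L else L ++ m :: R
  else hop_in x L ++ m :: hop_in x R.
Proof.
move=> uw bL bR; rewrite /hop_in mem_cat inE.
case: (altP (x =P m)) => [->|xm] /=; first by rewrite orbT hop_word_max.
case: (boolP (x \in L)) => xL /=.
  rewrite ifN; first by rewrite hop_word_left // (allP bL).
  apply/negP=> xR; move: uw; rewrite cat_uniq => /and3P[_ /hasPn/(_ x)].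
  by rewrite inE xR orbT xL => /(_ isT).
by case: ifP => // xR; rewrite hop_word_right // (allP bR).
Qed.

Lemma below_perm m s s' : perm_eq s s' -> below m s = below m s'.
Proof. exact: perm_all. Qed.

Lemma perm_swap L m R : perm_eq (R ++ m :: L) (L ++ m :: R).
Proof. by rewrite perm_catC /= -cat1s perm_catC -catA perm_cat2l perm_catC. Qed.

Lemma perm_hop_in x w : uniq w -> perm_eq (hop_in x w) w.
Proof.
elim/max_word_ind=> // L m R uw bL bR IHL IHR; rewrite hop_in_node //.
case: ifP => _; first by case: ifP => _; rewrite // perm_swap.
by rewrite perm_cat // perm_cons.
Qed.

Lemma perm_foldr_hop_in s w : uniq w -> perm_eq (foldr hop_in w s) w.
Proof.
move=> uw; elim: s => //= x s IHs.
by rewrite (perm_trans _ IHs) // perm_hop_in // (perm_uniq IHs).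
Qed.

Lemma nilp_perm s s' : perm_eq s s' -> nilp s = nilp s'.
Proof. by move/perm_size; rewrite /nilp => ->. Qed.

Lemma uniq_node L m R : uniq (L ++ m :: R) -> uniq L /\ uniq R.
Proof. by rewrite cat_uniq /= => /and4P[]. Qed.

(** * Hopping at a set of letters as a group action *)

Definition flip S w := foldr hop_in w (enum S).

Lemma perm_flip S w : uniq w -> perm_eq (flip S w) w.
Proof. exact: perm_foldr_hop_in. Qed.

(** A hop at [m] only exchanges the sides, and a hop at another letter acts inside a side without
    changing whether it is empty; so the position of [m] in the enumeration of [S] is immaterial. *)
Lemma flip_node S L m R : uniq (L ++ m :: R) -> below m L -> below m R ->
  flip S (L ++ m :: R) =
  if (m \in S) && (nilp L || nilp R) then flip S R ++ m :: flip S L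
  else flip S L ++ m :: flip S R.
Proof.
move=> uw bL bR; rewrite /flip -(mem_enum S).
have [uL uR] := uniq_node uw.
elim: (enum S) (enum_uniq S) => //= x s IHs /andP[xs us].
have pL := perm_foldr_hop_in s uL; have pR := perm_foldr_hop_in s uR.
rewrite {}IHs // inE; set L' := foldr _ L s in pL *; set R' := foldr _ R s in pR *.
have bL' : below m L' by rewrite (below_perm m pL).
have bR' : below m R' by rewrite (below_perm m pR).
have uw' : uniq (L' ++ m :: R').
  by rewrite (perm_uniq (perm_cat pL (_ : perm_eq (m :: R') (m :: R)))) // perm_cons.
have uw'' : uniq (R' ++ m :: L') by rewrite (perm_uniq (perm_swap L' m R')).
rewrite eq_sym; case: (altP (x =P m)) => [xm|xm] /=.
  (* [m] is absent from the rest of the list and from both sides, so it acts once, at the root, and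
     trivially on the sides. *)
  subst x; rewrite (negPf xs) /= hop_in_node // eqxx (nilp_perm pL) (nilp_perm pR).
  have [mL mR] : m \notin L' /\ m \notin R'.
    by split; apply/negP; [move/(allP bL')|move/(allP bR')]; rewrite ltnn.
  by rewrite /hop_in (negPf mL) (negPf mR).
by case: ifP => _; rewrite hop_in_node // (negPf xm).
Qed.

Lemma flip_set1 x w : flip [set x] w = hop_in x w.
Proof. by rewrite /flip enum_set1. Qed.

Lemma flip_nil S : flip S [::] = [::].
Proof. by rewrite /flip; elim: (enum S) => //= x s ->. Qed.

Lemma eq_flip S T w : uniq w -> {in w, S =i T} -> flip S w = flip T w.
Proof.
move=> uw; elim/max_word_ind: w / uw => [|L m R uw bL bR IHL IHR] eqST.
  by rewrite !flip_nil.
rewrite !flip_node // (eqST m) ?mem_cat ?inE ?eqxx ?orbT //.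
have -> : flip S L = flip T L by apply: IHL => x xL; rewrite eqST // mem_cat xL.
by have -> : flip S R = flip T R by apply: IHR => x xR; rewrite eqST // mem_cat inE xR !orbT.
Qed.

Lemma flip_set0 w : flip set0 w = w.
Proof. by rewrite /flip enum_set0. Qed.

Lemma flip_off S w : uniq w -> {in w, forall x, x \notin S} -> flip S w = w.
Proof.
move=> uw Sw; rewrite -[RHS]flip_set0; apply: eq_flip => // x xw.
by rewrite inE (negPf (Sw x xw)).
Qed.

Lemma uniq_flip_node S L m R : uniq (L ++ m :: R) -> below m L -> below m R ->
  [/\ below m (flip S L), below m (flip S R),
      uniq (flip S L ++ m :: flip S R) & uniq (flip S R ++ m :: flip S L)].
Proof.
move=> uw bL bR; have [uL uR] := uniq_node uw.
have pL := perm_flip S uL; have pR := perm_flip S uR.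
have uw' : uniq (flip S L ++ m :: flip S R).
  by rewrite (perm_uniq (perm_cat pL (_ : perm_eq (m :: flip S R) (m :: R)))) // perm_cons.
by rewrite (perm_uniq (perm_swap (flip S L) m (flip S R))) !(below_perm _ pL, below_perm _ pR).
Qed.

Definition symdiff S T := [set x | (x \in S) (+) (x \in T)].

(** If one side is empty, two hops at [m] cancel; otherwise [m] never moves. In either case only the
    parity of the number of hops at [m] counts. *)
Lemma flip_flip S T w : uniq w -> flip S (flip T w) = flip (symdiff S T) w.
Proof.
elim/max_word_ind=> [|L m R uw bL bR IHL IHR]; first by rewrite !flip_nil.
have [bL' bR' uw' uw''] := uniq_flip_node T uw bL bR.
have [uL uR] := uniq_node uw.
rewrite !(flip_node _ uw) // inE -IHL -IHR.
have [nL nR] := (nilp_perm (perm_flip T uL), nilp_perm (perm_flip T uR)).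
case: (boolP (m \in T)) => mT /=; last by rewrite flip_node // addbF nL nR.
case: (boolP (nilp L || nilp R)) => LR; last by rewrite flip_node // nL nR (negPf LR) !andbF.
by rewrite flip_node // nL nR orbC LR addbT; case: (m \in S).
Qed.

Lemma rev_node L m R : rev (L ++ m :: R) = rev R ++ m :: rev L.
Proof. by rewrite rev_cat rev_cons cat_rcons. Qed.

Lemma rev_flip S w : uniq w -> rev (flip S w) = flip S (rev w).
Proof.
elim/max_word_ind=> [|L m R uw bL bR IHL IHR]; first by rewrite !flip_nil.
rewrite rev_node !flip_node ?below_rev //; last by rewrite -rev_node rev_uniq.
by rewrite /nilp !size_rev orbC -IHL -IHR; case: ifP => _; rewrite rev_node.
Qed.

(** * Locked letters and the reversal twisted by them *)

Implicit Types F G : seq 'I_n -> {set 'I_n}.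

(* [b] selects the side on which the locked letters of a word continue when its *)
(* maximum is a peak: they are on the right for [Rix], on the left for [foata]. *)
Definition locking (b : bool) F :=
  [/\ F [::] = set0,
      forall m R, uniq (m :: R) -> below m R -> F (m :: R) = [set m],
      forall L m, uniq (rcons L m) -> below m L -> F (rcons L m) = m |: F L
    & forall L m R, uniq (L ++ m :: R) -> below m L -> below m R ->
        ~~ nilp L -> ~~ nilp R -> F (L ++ m :: R) = F (if b then R else L)].

Lemma locking_sub b F w : locking b F -> uniq w -> {subset F w <= w}.
Proof.
case=> F0 Fl Fr Fn; elim/max_word_ind=> [|L m R uw bL bR IHL IHR] x.
  by rewrite F0 inE.
case: (boolP (nilp L)) => [/nilP L0|L0].
  by subst L; rewrite Fl // inE => /eqP->; rewrite mem_head.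
case: (boolP (nilp R)) => [/nilP R0|R0].
  subst R; rewrite cats1 in uw *; rewrite Fr // mem_rcons !inE.
  by case/predU1P=> [->|/IHL->]; rewrite ?eqxx ?orbT.
by rewrite Fn // mem_cat inE; case: b {Fl Fr Fn} => [/IHR->|/IHL->]; rewrite ?orbT.
Qed.

(** A maximum at an end is locked, hence not in [S], and an interior maximum cannot move. So the
    shape of every node met by the recursion for [F] is unchanged. *)
Lemma locking_flip b F S w : locking b F -> uniq w -> [disjoint S & F w] ->
  F (flip S w) = F w.
Proof.
case=> F0 Fl Fr Fn; elim/max_word_ind=> [|L m R uw bL bR IHL IHR] dSF.
  by rewrite flip_nil.
have [bL' bR' uw' uw''] := uniq_flip_node S uw bL bR.
have [uL uR] := uniq_node uw.
have [nL nR] := (nilp_perm (perm_flip S uL), nilp_perm (perm_flip S uR)).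
rewrite flip_node //.
case: (boolP (nilp L)) => [/nilP L0|L0].
  subst L; rewrite Fl // disjoint_sym disjoints1 in dSF; rewrite (negPf dSF) /=.
  by rewrite flip_nil /= in uw' *; rewrite !Fl.
case: (boolP (nilp R)) => [/nilP R0|R0].
  subst R; rewrite flip_nil !cats1 in uw uw' dSF *; rewrite Fr // in dSF *.
  have [mS dL] : m \notin S /\ [disjoint S & F L].
    move: dSF; rewrite disjoint_sym => dSF; rewrite disjoint_sym.
    rewrite (disjointWl _ dSF) ?subsetUr //; split=> //.
    by rewrite -disjoints1 (disjointWl _ dSF) // subsetUl.
  by rewrite (negPf mS) Fr // IHL.
rewrite andbF !Fn ?nL ?nR //; rewrite Fn // in dSF.
by case: b {Fl Fr Fn} dSF => [/IHR|/IHL].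
Qed.

(* For F = rix_locked this is foata o Phi on words, see word_foata_Phi. *)
Definition lock_rev F w := flip (F w) (rev w).

(** After reversal, a maximum at an end is locked and hops back to its original end. At an interior
    maximum all locked letters lie on one side, so the other side is merely reversed. *)
Lemma lock_rev_node b F L m R : locking b F ->
  uniq (L ++ m :: R) -> below m L -> below m R ->
  lock_rev F (L ++ m :: R) =
  if nilp L then m :: rev R else if nilp R then rcons (lock_rev F L) m
  else if b then lock_rev F R ++ m :: rev L else rev R ++ m :: lock_rev F L.
Proof.
move=> lF uw bL bR; have [F0 Fl Fr Fn] := lF.
have urw : uniq (rev R ++ m :: rev L) by rewrite -rev_node rev_uniq.
have [uL uR] := uniq_node uw.
rewrite /lock_rev rev_node flip_node ?below_rev // /nilp !size_rev.
have off s (S : {set 'I_n}) : uniq s -> {subset S <= predC (mem s)} -> flip S (rev s) = rev s.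
  move=> us sS; apply: flip_off; rewrite ?rev_uniq // => x; rewrite mem_rev => xs.
  by apply: contraTN xs => /sS.
have mR : m \notin R by apply/negP=> /(allP bR); rewrite ltnn.
have mL : m \notin L by apply/negP=> /(allP bL); rewrite ltnn.
case: (boolP (size L == 0)) => [/nilP L0|L0].
  subst L; rewrite orbT Fl // set11 /= flip_nil off //.
  by move=> x /set1P->.
case: (boolP (size R == 0)) => [/nilP R0|R0].
  subst R; rewrite cats1 in uw *; rewrite Fr // setU11 /= flip_nil cats1; congr rcons.
  apply: eq_flip; rewrite ?rev_uniq // => x; rewrite mem_rev => xL; rewrite !inE.
  by case: eqP mL => // <-; rewrite xL.
rewrite andbF Fn //.
have dis x : x \in L -> x \in R -> false.
  move=> xL xR; move: uw; rewrite cat_uniq => /and3P[_ /hasPn/(_ x)].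
  by rewrite inE xR orbT xL => /(_ isT).
case: b {Fl Fr Fn} lF => lF; [rewrite (off L) // | rewrite (off R) //].
  by move=> x /(locking_sub lF uR) xR; apply/negP=> xL; have := dis x xL xR.
by move=> x /(locking_sub lF uL) xL; apply/negP=> xR; have := dis x xL xR.
Qed.

Lemma perm_lock_rev F w : uniq w -> perm_eq (lock_rev F w) w.
Proof.
move=> uw; have urw : uniq (rev w) by rewrite rev_uniq.
by rewrite (perm_trans (perm_flip _ urw)) // perm_rev.
Qed.

(** Reversal carries the side that holds the locked letters across an interior maximum, which turns
    the recursion for [b] into the one for [~~ b]. *)
Lemma lock_rev_locking b F G w : locking b F -> locking (~~ b) G -> uniq w ->
  G (lock_rev F w) = F w.
Proof.
move=> lF lG; have [F0 Fl Fr Fn] := lF; have [G0 Gl Gr Gn] := lG.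
elim/max_word_ind=> [|L m R uw bL bR IHL IHR].
  by rewrite F0 /lock_rev F0 flip_set0 /rev /=.
have [uL uR] := uniq_node uw.
have [pL pR] := (perm_lock_rev F uL, perm_lock_rev F uR).
have [nL nR] := (nilp_perm pL, nilp_perm pR).
have puw := perm_lock_rev F uw; have uw' := perm_uniq puw; rewrite uw in uw'.
move: uw'; rewrite (lock_rev_node lF) //.
case: ifP => [/nilP L0|L0].
  by subst L => uw'; rewrite Fl // Gl ?below_rev.
case: ifP => [/nilP R0|R0].
  by subst R => uw'; rewrite cats1 in uw *; rewrite Fr // Gr ?(below_perm _ pL) // IHL.
rewrite Fn ?L0 ?R0 //; case: b {Fl Fr Fn Gl Gr lF lG} Gn => Gn uw'.
  by rewrite Gn ?(below_perm _ pR) ?below_rev ?nR ?L0 ?R0 // /nilp size_rev [_ == _]L0.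
by rewrite Gn ?(below_perm _ pL) ?below_rev ?nL ?L0 ?R0 // /nilp size_rev [_ == _]R0.
Qed.

(** Both maps flip by the same set, by [lock_rev_locking]; since reversal commutes with flips, the
    two flips and the two reversals cancel. *)
Lemma lock_revK b F G w : locking b F -> locking (~~ b) G -> uniq w ->
  lock_rev G (lock_rev F w) = w.
Proof.
move=> lF lG uw; rewrite {1}/lock_rev (lock_rev_locking lF lG) // /lock_rev.
rewrite rev_flip ?rev_uniq // revK flip_flip //.
by apply: flip_off => // x _; rewrite inE addbb.
Qed.

Lemma lock_rev_flip b F S w : locking b F -> uniq w -> [disjoint S & F w] ->
  lock_rev F (flip S w) = flip S (lock_rev F w).
Proof.
move=> lF uw dS; rewrite /lock_rev (locking_flip lF) // rev_flip //.
rewrite !flip_flip ?rev_uniq //; apply: eq_flip; rewrite ?rev_uniq // => x _.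
by rewrite !inE addbC.
Qed.

(** * The rix-factorization *)

Lemma rix_recS k w (i := find (largest_descent w) w) (r := rix_rec k (drop i.+1 w)) :
  rix_rec k.+1 w =
  if increasing w || (i == 0) then ([::], w) else (take i.+1 w :: r.1, r.2).
Proof. by rewrite /r /=; case: ifP => // _; case: rix_rec. Qed.

Lemma rix_rec_fuel k k' w : size w <= k -> size w <= k' -> rix_rec k w = rix_rec k' w.
Proof.
elim: k k' w => [|k IHk] [|k'] [|x w] // wk wk'.
rewrite !rix_recS; case: ifP => // _; rewrite (IHk k') //= size_drop.
  by move: wk => /=; lia.
by move: wk' => /=; lia.
Qed.

Lemma descent_cat L x R : x \notin L -> descent (L ++ x :: R) x = (first R < x).
Proof. by move=> xL; rewrite /descent rnbr_cat. Qed.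

Lemma descent_mem w x : descent w x -> x \in w.
Proof.
apply: contraLR => xw; rewrite /descent /rnbr (memNindex xw) nth_default ?size_map //.
by rewrite -leqNgt ltnW.
Qed.

(** A maximum appended at the end replaces the border at infinity for the letter before it, and is
    itself followed by infinity. *)
Lemma descent_rcons L m : uniq (rcons L m) -> below m L ->
  descent (rcons L m) =1 descent L.
Proof.
move=> uw bL x; case: (boolP (x \in rcons L m)) => [|xw]; last first.
  apply/idP/idP => /descent_mem; first by rewrite (negPf xw).
  by move=> xL; rewrite mem_rcons inE xL orbT in xw.
rewrite mem_rcons inE => /predU1P[->|xL].
  have mL : m \notin L by move: uw; rewrite rcons_uniq => /andP[].
  rewrite -cats1 descent_cat // /first /= ltnNge ltnW //=.
  by apply/esym/negP=> /descent_mem; rewrite (negPf mL).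
move: (allP bL _ xL) uw => xm; case/splitPr: xL => A B uw.
have xA : x \notin A.
  by move: uw; rewrite rcons_cat cat_uniq /= negb_or => /and3P[_ /andP[]].
rewrite rcons_cat rcons_cons !descent_cat //; case: B {uw} => //=.
by rewrite /first /= !ltnNge (ltnW xm) (ltnW (ltn_ord x)).
Qed.

Lemma descent_exists w : uniq w -> ~~ increasing w -> exists x, descent w x.
Proof.
elim: w => [//|x [//|y w] IHw] uw; have [xw uw'] := andP uw.
rewrite /increasing /= negb_and => /orP[xy|].
  exists x; rewrite (@descent_cat [::]) //= /first /=.
  rewrite -leqNgt in xy; rewrite ltn_neqAle xy andbT.
  by move: xw; rewrite inE negb_or eq_sym => /andP[].
case/(IHw uw') => z dz; exists z.
have xz : x != z by apply: contraNneq xw => ->; apply: descent_mem dz.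
by move: dz; rewrite /descent /rnbr [index z (x :: _)]/= (negPf xz).
Qed.

Lemma has_largest_descent w : uniq w -> ~~ increasing w -> has (largest_descent w) w.
Proof.
move=> uw /(descent_exists uw)[x dx]; apply/hasP.
case: (@arg_maxnP _ x (descent w) val dx) => y dy y_max.
exists y; first exact: descent_mem.
by rewrite /largest_descent dy; apply/allP=> z _; apply/implyP=> /y_max.
Qed.

Lemma largest_descent_max L m R : uniq (L ++ m :: R) -> below m L -> below m R ->
  ~~ nilp R -> largest_descent (L ++ m :: R) m.
Proof.
move=> uw bL bR R0; rewrite /largest_descent descent_cat ?first_below // ?R0 /=.
  apply/allP=> y; rewrite mem_cat inE => yw; apply/implyP=> _.
  by case/or3P: yw => [/(allP bL)/ltnW|/eqP->|/(allP bR)/ltnW].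
by apply/negP=> /(allP bL); rewrite ltnn.
Qed.

Lemma find_largest_descent_max L m R : uniq (L ++ m :: R) -> below m L -> below m R ->
  ~~ nilp R -> find (largest_descent (L ++ m :: R)) (L ++ m :: R) = size L.
Proof.
move=> uw bL bR R0; have mw := largest_descent_max uw bL bR R0.
rewrite find_cat ifN; first by rewrite /= mw addn0.
apply/hasPn=> y yL; apply/negP=> /andP[_ /allP/(_ m)].
rewrite mem_cat mem_head orbT (andP mw).1 => /(_ isT) /=.
by rewrite leqNgt (allP bL).
Qed.

(** Either the word is increasing, or its largest descent is its first letter; the algorithm stops
    at once in both cases. *)
Lemma rix_fact_cons m R : uniq (m :: R) -> below m R -> rix_fact (m :: R) = ([::], m :: R).
Proof.
move=> uw bR; rewrite /rix_fact [size _]/= rix_recS.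
case: (boolP (nilp R)) => [/nilP->|R0] //.
by rewrite -[m :: R]cat0s find_largest_descent_max ?orbT.
Qed.

Lemma increasing_node L m R : below m R -> ~~ nilp R -> increasing (L ++ m :: R) = false.
Proof.
case: R => //= x R /andP[xm _] _; rewrite /increasing; case: L => [|y L] /=.
  by rewrite ltnNge ltnW.
by rewrite cat_path /= [m < x]ltnNge (ltnW xm) /= !andbF.
Qed.

Lemma rix_fact_node L m R : uniq (L ++ m :: R) -> below m L -> below m R ->
  ~~ nilp L -> ~~ nilp R ->
  rix_fact (L ++ m :: R) = (rcons L m :: (rix_fact R).1, (rix_fact R).2).
Proof.
move=> uw bL bR L0 R0; rewrite /rix_fact {1}size_cat addnS rix_recS.
rewrite increasing_node // find_largest_descent_max // [_ == 0](negPf L0) /=.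
rewrite -cat_rcons -(size_rcons L m) take_size_cat // drop_size_cat //.
by rewrite (@rix_rec_fuel _ (size R)) ?leq_addl.
Qed.

Lemma sorted_rcons_below L m : below m L -> increasing (rcons L m) = increasing L.
Proof.
rewrite /increasing; case: L => [|x L] // bL; rewrite /= rcons_path.
by case: (path _ x L) => //=; apply: (allP bL); apply: mem_last.
Qed.

Lemma find_rcons_has (U : Type) (a : pred U) (s : seq U) (x : U) :
  has a s -> find a (rcons s x) = find a s.
Proof. by move=> as_; rewrite -cats1 find_cat as_. Qed.

(** An appended maximum changes neither the test for increasing words nor the descents, so every cut
    is made at the same place and [m] ends up in the last factor. *)
Lemma rix_rec_rcons k L m : uniq (rcons L m) -> below m L -> size L <= k ->
  rix_rec k.+1 (rcons L m) = ((rix_rec k L).1, rcons (rix_rec k L).2 m).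
Proof.
elim: k L => [|k IHk] L uw bL Lk; first by case: L Lk {uw bL}.
have uL : uniq L by move: uw; rewrite rcons_uniq => /andP[].
rewrite rix_recS [in RHS]rix_recS sorted_rcons_below //; case: (boolP (increasing L)) => // incL.
have hL := has_largest_descent uL incL.
have eqP : largest_descent (rcons L m) =1 largest_descent L.
  move=> x; rewrite /largest_descent descent_rcons // all_rcons descent_rcons //.
  have -> : descent L m = false.
    by apply/negP=> /descent_mem; move: uw; rewrite rcons_uniq => /andP[/negPf->].
  by congr (_ && _); apply: eq_all => y /=; rewrite descent_rcons.
rewrite (eq_find eqP) find_rcons_has // !orFb; case: ifP => // _.
set i := find _ _; have iL : i < size L by rewrite -has_find.
rewrite drop_rcons // -[rcons L m]cats1 takel_cat //.
have uD : uniq (rcons (drop i.+1 L) m).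
  by rewrite rcons_uniq drop_uniq // andbT; apply/negP=> /mem_drop/(allP bL); rewrite ltnn.
rewrite IHk // ?size_drop; last 2 first.
- by apply/allP=> y /mem_drop/(allP bL).
- by lia.
Qed.

Lemma rix_fact_rcons L m : uniq (rcons L m) -> below m L ->
  rix_fact (rcons L m) = ((rix_fact L).1, rcons (rix_fact L).2 m).
Proof. by move=> uw bL; rewrite /rix_fact size_rcons rix_rec_rcons. Qed.

Lemma rix_fact_nilp w : uniq w -> nilp (rix_fact w).2 = nilp w.
Proof.
elim/max_word_ind=> // L m R uw bL bR IHL IHR.
case: (boolP (nilp R)) => [/nilP R0|R0].
  by subst R; rewrite cats1 in uw *; rewrite rix_fact_rcons // /nilp !size_rcons.
case: (boolP (nilp L)) => [/nilP L0|L0]; first by subst L; rewrite rix_fact_cons.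
by rewrite rix_fact_node // IHR (negPf R0) /nilp size_cat addnS.
Qed.

Lemma beta1_rcons L m : uniq (rcons L m) -> below m L ->
  beta1 (rcons L m) = if nilp L then m : nat else beta1 L.
Proof.
move=> uw bL; rewrite /beta1 rix_fact_rcons //.
have uL : uniq L by move: uw; rewrite rcons_uniq => /andP[].
by have := rix_fact_nilp uL; case: (rix_fact L).2 => [<-|? ? <-].
Qed.

Lemma incr_suffix_cons x L :
  incr_suffix (x :: L) = if increasing (x :: L) then x :: L else incr_suffix L.
Proof. by []. Qed.

Lemma incr_suffix_node L m R : below m R -> ~~ nilp R ->
  incr_suffix (L ++ m :: R) = incr_suffix R.
Proof.
move=> bR R0; elim: L => [|x L IHL].
  by rewrite incr_suffix_cons (increasing_node [::] bR R0).
by rewrite cat_cons incr_suffix_cons (increasing_node (x :: L) bR R0).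
Qed.

Lemma incr_suffix_rcons L m : below m L ->
  incr_suffix (rcons L m) = rcons (incr_suffix L) m.
Proof.
elim: L => [|x L IHL] // /[dup] bL /andP[_ /IHL IH].
by rewrite rcons_cons !incr_suffix_cons -rcons_cons sorted_rcons_below // IH; case: ifP.
Qed.

(** This keeps an appended maximum [m] in the filter that defines [Rix]. *)
Lemma beta1_below m L : below m L -> uniq L -> ~~ nilp L -> beta1 L < m.
Proof.
move=> bL uL; elim/max_word_ind: L / uL bL => // L x R uw bL bR IHL IHR.
rewrite /below all_cat /= => /and3P[bmL xm bmR] _.
case: (boolP (nilp R)) => [/nilP R0|R0].
  by subst R; rewrite cats1 in uw *; rewrite beta1_rcons //; case: ifP => // L0; rewrite IHL ?L0.
case: (boolP (nilp L)) => [/nilP L0|L0]; first by subst L; rewrite /beta1 rix_fact_cons.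
by rewrite /beta1 rix_fact_node //; apply: IHR.
Qed.

Lemma Rix_cons m R : uniq (m :: R) -> below m R -> ~~ nilp R -> Rix (m :: R) = [::].
Proof.
move=> uw bR R0; rewrite /Rix -[m :: R]cat0s incr_suffix_node // cat0s /beta1.
rewrite rix_fact_cons //= -(filter_pred0 (incr_suffix R)); apply: eq_in_filter => x xR.
have : x \in R.
  elim: R {uw bR R0} xR => //= y R IH; case: ifP => // _ /IH; rewrite inE => ->.
  by rewrite orbT.
by move/(allP bR) => xm; rewrite /first /= leqNgt xm.
Qed.

Lemma Rix_node L m R : uniq (L ++ m :: R) -> below m L -> below m R ->
  ~~ nilp L -> ~~ nilp R -> Rix (L ++ m :: R) = Rix R.
Proof. by move=> *; rewrite /Rix incr_suffix_node // /beta1 rix_fact_node. Qed.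

Lemma Rix_rcons L m : uniq (rcons L m) -> below m L -> Rix (rcons L m) = rcons (Rix L) m.
Proof.
move=> uw bL; have [mL uL] : m \notin L /\ uniq L.
  by move: uw; rewrite rcons_uniq => /andP[].
rewrite /Rix incr_suffix_rcons // filter_rcons beta1_rcons //.
case: (boolP (nilp L)) => [/nilP->|L0]; first by rewrite /= leqnn.
by rewrite ltnW // beta1_below.
Qed.

Definition rix_locked w := [set x | (x \in Rix w) || (val x == beta1 w)].

Lemma rix_locking : locking true rix_locked.
Proof.
split.
- by apply/setP=> x; rewrite !inE /beta1 /= /first /= ltn_eqF.
- move=> m R uw bR; apply/setP=> x; rewrite !inE.
  (* A single letter is both rixed and the first letter of beta; for [R] nonempty there is no rixed
     point, and [m] is locked only as that first letter. *)
  case: (boolP (nilp R)) => [/nilP R0|R0].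
    by subst R; rewrite /Rix /beta1 /= /first /= leqnn inE orbb.
  by rewrite Rix_cons // /beta1 rix_fact_cons.
- move=> L m uw bL; apply/setP=> x; rewrite !inE Rix_rcons // mem_rcons inE beta1_rcons //.
  case: (boolP (nilp L)) => [/nilP->|_]; last by rewrite -orbA.
  by rewrite /Rix /beta1 /= /first /= (ltn_eqF (ltn_ord x)) !orbF orbb.
- by move=> L m R *; apply/setP=> x; rewrite !inE Rix_node // /beta1 rix_fact_node.
Qed.

Lemma Phi_cycles_cons m R : uniq (m :: R) -> below m R -> Phi_cycles (m :: R) = [:: m :: rev R].
Proof.
move=> uw bR; rewrite /Phi_cycles rix_fact_cons //.
case: (boolP (nilp R)) => [/nilP->|R0].
  by rewrite /Rix /beta1 /= /first /= leqnn.
by rewrite Rix_cons //= take_size.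
Qed.

Lemma Phi_cycles_node L m R : uniq (L ++ m :: R) -> below m L -> below m R ->
  ~~ nilp L -> ~~ nilp R -> Phi_cycles (L ++ m :: R) = (m :: rev L) :: Phi_cycles R.
Proof.
move=> *; rewrite /Phi_cycles Rix_node // rix_fact_node //.
by case: (rix_fact R) => a b /=; rewrite rev_rcons.
Qed.

(** Beta and [Rix] both grow by the letter [m], so delta stays the same. *)
Lemma Phi_cycles_rcons L m : uniq (rcons L m) -> below m L ->
  Phi_cycles (rcons L m) = rcons (Phi_cycles L) [:: m].
Proof.
move=> uw bL; rewrite /Phi_cycles Rix_rcons // rix_fact_rcons //.
case: (rix_fact L) => a b /=; rewrite !size_rcons subSS -cats1 takel_cat ?leq_subr //.
by rewrite map_rcons -!cats1 !catA.
Qed.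

(* The letters that are fixed points of the permutation with foata image w. *)
Definition fixed_letter w x :=
  [&& x \in w, below x (take (index x w) w) & x < rnbr w x].

Lemma fixed_letter_cat L x R : x \notin L ->
  fixed_letter (L ++ x :: R) x = below x L && (x < first R).
Proof.
move=> xL; rewrite /fixed_letter mem_cat mem_head orbT rnbr_cat //.
by rewrite index_pivot // take_size_cat.
Qed.

(** No letter to the right of [m] is a left-to-right maximum, and for the letters of [L] the letter
    [m] acts as the border at infinity. *)
Lemma fixed_letter_node L m R x : uniq (L ++ m :: R) -> below m L -> below m R ->
  fixed_letter (L ++ m :: R) x = (x == m) && nilp R || fixed_letter L x.
Proof.
move=> uw bL bR; have mL : m \notin L by apply/negP=> /(allP bL); rewrite ltnn.
case: (altP (x =P m)) => [->|xm] /=.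
  by rewrite fixed_letter_cat // bL lt_first_below // /fixed_letter (negPf mL) orbF.
case: (boolP (x \in L)) => xL.
  have := allP bL _ xL; case/splitPr: xL uw {bL mL} => A B uw ltxm.
  have xA : x \notin A.
    by move: uw; rewrite -catA cat_uniq /= negb_or => /and3P[_ /andP[]].
  rewrite -catA cat_cons !fixed_letter_cat //; case: B {uw} => //=.
  by rewrite /first /= ltxm ltn_ord.
rewrite [RHS]/fixed_letter (negPf xL) /=; apply/negP=> /and3P[+ + _].
rewrite mem_cat inE (negPf xL) (negPf xm) /= => xR.
have := allP bR _ xR; case/splitPr: xR uw {bR} => A B uw ltxm.
have xA : x \notin L ++ m :: A.
  by move: uw; rewrite -cat_cons catA cat_uniq /= negb_or => /and3P[_ /andP[]].
rewrite -cat_cons catA index_pivot // take_size_cat // /below all_cat /=.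
by rewrite ltnNge ltnW // !andbF.
Qed.

Definition foata_locked w := [set x | fixed_letter w x || (val x == first w)].

Lemma foata_locking : locking false foata_locked.
Proof.
split.
- by apply/setP=> x; rewrite !inE /fixed_letter /= /first /= ltn_eqF.
- move=> m R uw bR; apply/setP=> x; rewrite !inE.
  rewrite (@fixed_letter_node [::]) // /fixed_letter /= orbF.
  by rewrite /first /= val_eqE; case: (x == m); rewrite ?orbT.
- move=> L m uw bL; apply/setP=> x; rewrite !inE.
  rewrite -cats1 in uw *; rewrite fixed_letter_node // andbT -orbA.
  case: L {uw bL} => //=; rewrite /first /= (ltn_eqF (ltn_ord x)) orbF /fixed_letter /=.
  by rewrite orbb.
move=> L m R uw bL bR L0 R0; apply/setP=> x; rewrite !inE fixed_letter_node //.
by rewrite (negPf R0) andbF; case: L L0 {uw bL}.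
Qed.

(** * Canonical cycle representations *)

(** Lists of cycles are grown on the right, so that the last cycle starts at the maximum of the
    flattened word; this matches the decomposition L m R. *)
Inductive canonical : seq (seq 'I_n) -> Prop :=
  | canonical_nil : canonical [::]
  | canonical_rcons cs m R : canonical cs -> below m (flatten cs) -> below m R ->
      canonical (rcons cs (m :: R)).

Lemma canonical_exists w : uniq w -> exists2 cs, canonical cs & flatten cs = w.
Proof.
elim/max_word_ind=> [|L m R uw bL bR [cs ccs csL] _].
  by exists [::] => //; constructor.
exists (rcons cs (m :: R)); last by rewrite flatten_rcons csL.
by constructor; rewrite ?csL.
Qed.

Lemma canonical_head_max cs c : canonical cs -> c \in cs ->
  exists2 m, ohead c = Some m & below m (behead c).
Proof.
move=> ccs; elim: cs / ccs => // cs m R _ IH _ bR.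
by rewrite mem_rcons inE => /predU1P[->|/IH //]; exists m.
Qed.

Lemma canonical_heads_increasing cs : canonical cs -> increasing (pmap ohead cs).
Proof.
move=> ccs; elim: cs / ccs => // cs m R _ IH bcs _.
rewrite -cats1 pmap_cat cats1 sorted_rcons_below //.
apply/allP=> x; rewrite mem_pmap => /mapP[[|y s] // sc [->]].
by apply: (allP bcs); apply/flattenP; exists (y :: s); rewrite // mem_head.
Qed.

Lemma fixed_letter_canonical cs x : canonical cs -> uniq (flatten cs) ->
  fixed_letter (flatten cs) x = ([:: x] \in cs).
Proof.
move=> ccs; elim: cs / ccs => // cs m R _ IH bcs bR.
rewrite flatten_rcons => uw; have [ucs _] := uniq_node uw.
rewrite fixed_letter_node // IH // mem_rcons inE eqseq_cons.
by congr (_ && _ || _); case: (R).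
Qed.

Definition cycles_perm (cs : seq (seq 'I_n)) : 'S_n := (\prod_(c <- cs) cycle_perm c)%g.

Lemma cycle_permE c x : uniq c -> cycle_perm c x = next c x.
Proof. by move=> uc; rewrite permE undup_id. Qed.

Lemma next_notin c x : x \notin c -> next c x = x.
Proof. by move=> xc; rewrite next_nth (negPf xc). Qed.

Lemma cycles_permE cs c x : uniq (flatten cs) -> c \in cs -> x \in c ->
  cycles_perm cs x = next c x.
Proof.
have out ds y : uniq (flatten ds) -> y \notin flatten ds -> cycles_perm ds y = y.
  rewrite /cycles_perm; elim: ds => [|d ds IHds] /= uw yds; first by rewrite big_nil perm1.
  move: uw yds; rewrite cat_uniq mem_cat negb_or => /and3P[ud _ uds] /andP[yd yds].
  by rewrite big_cons permM cycle_permE // next_notin // IHds.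
elim: cs => //= d cs IHcs; rewrite cat_uniq => /and3P[ud dis ucs].
rewrite inE /cycles_perm big_cons permM => /predU1P[->|ccs] xc.
  rewrite cycle_permE // out //; apply: contraNN dis => ncs.
  by apply/hasP; exists (next d x); rewrite ?mem_next.
rewrite cycle_permE // next_notin ?IHcs //.
by apply: contraNN dis => xd; apply/hasP; exists x => //; apply/flattenP; exists c.
Qed.

Lemma uniq_flatten_mem (cs : seq (seq 'I_n)) c : uniq (flatten cs) -> c \in cs -> uniq c.
Proof.
elim: cs => //= d cs IHcs; rewrite cat_uniq => /and3P[ud _ ucs].
by rewrite inE => /predU1P[->|/IHcs]; last exact.
Qed.

Lemma fcycle_cycles_perm cs c : uniq (flatten cs) -> c \in cs -> fcycle (cycles_perm cs) c.
Proof.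
move=> ucs ccs; apply: cycle_from_next; first exact: uniq_flatten_mem ccs.
by move=> x xc /=; rewrite (cycles_permE ucs ccs).
Qed.

Lemma cycles_perm_fix cs x : uniq (flatten cs) -> x \in flatten cs ->
  (cycles_perm cs x == x) = ([:: x] \in cs).
Proof.
move=> ucs /flattenP[c ccs xc]; apply/eqP/idP => [qx|]; last first.
  by move/(cycles_permE ucs)/(_ (mem_head _ _)); rewrite /= eqxx.
(* The letters of a cycle are iterates of any one of them, so a cycle through a fixed point has no
   other letter. *)
have cx y : y \in c -> y = x.
  move=> yc; have := fconnect_cycle (fcycle_cycles_perm ucs ccs) xc y.
  rewrite yc => /iter_findex <-; exact: iter_fix.
have := uniq_flatten_mem ucs ccs; case: c => [|y [|z c]] // in ccs xc cx *.
  by rewrite (cx y) ?mem_head // in ccs.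
by rewrite /= inE (cx y) ?mem_head // (cx z) ?inE ?eqxx ?orbT.
Qed.

(** The heads of [cs] are the letters that are largest in their orbit, and the orbit started at a
    head is its cycle. The rearrangement [ds] is allowed because disjoint cycles commute and
    [Phi_cycles] is not listed in canonical order. *)
Lemma canonical_cycles_perm cs ds : canonical cs -> perm_eq (flatten cs) (enum 'I_n) ->
  perm_eq ds cs -> canonical_cycles (cycles_perm ds) = cs.
Proof.
move=> ccs pcs pds; set q := cycles_perm ds.
have uds : uniq (flatten ds).
  by rewrite (perm_uniq (perm_flatten pds)) (perm_uniq pcs) enum_uniq.
have qE c x : c \in cs -> x \in c -> fingraph.orbit q x = rot (index x c) c.
  rewrite -(perm_mem pds) => cds xc; apply: fingraph.orbitE => //.
    exact: fcycle_cycles_perm.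
  exact: uniq_flatten_mem cds.
have qhead c m : c \in cs -> ohead c = Some m -> fingraph.orbit q m = c.
  move=> cs_c; case: c cs_c => //= y c cs_c [<-].
  by rewrite (qE _ _ cs_c) ?mem_head //= eqxx rot0.
have -> : cs = map (fingraph.orbit q) (pmap ohead cs).
  have: {subset cs <= cs} by [].
  elim: {1 3 4}cs => //= c s IHs sub.
  have [m cm _] := canonical_head_max ccs (sub _ (mem_head _ _)).
  rewrite cm /= (qhead _ _ (sub _ (mem_head _ _)) cm) -IHs // => d ds'.
  by apply: sub; rewrite inE ds' orbT.
rewrite /canonical_cycles; congr map.
(* Two strictly increasing lists with the same members coincide. *)
apply: (@irr_sorted_eq _ (fun x y : 'I_n => x < y)).
- by move=> ? ? ?; apply: ltn_trans.
- by move=> ?; rewrite /= ltnn.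
- apply: sorted_filter; first by move=> ? ? ?; apply: ltn_trans.
  have := iota_ltn_sorted 0 n; rewrite -val_enum_ord.
  by rewrite sorted_map.
- exact: canonical_heads_increasing.
move=> x; rewrite mem_filter mem_enum andbT mem_pmap.
have: x \in flatten cs by rewrite (perm_mem pcs) mem_enum.
case/flattenP=> c cs_c xc; rewrite (qE c x) //.
have [m cm bm] := canonical_head_max ccs cs_c.
rewrite (perm_all _ (permEl (perm_rot _ _))); apply/idP/mapP => [x_max|[d cs_d dx]].
  exists c => //; rewrite cm; congr Some; apply/val_inj/eqP.
  case: c cm bm xc x_max {cs_c} => //= y c [->] bm.
  rewrite inE => /predU1P[->|/(allP bm)]; first by rewrite eqxx.
  by move=> xm /andP[/leq_ltn_trans/(_ xm)]; rewrite ltnn.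
have [y dy bd] := canonical_head_max ccs cs_d.
have := qhead _ _ cs_d (esym dx); rewrite (qE _ _ cs_c xc) => rd.
rewrite -(perm_all _ (permEl (perm_rot (index x c) c))) rd.
case: d dx dy bd {cs_d rd} => //= z d [->] [<-] bd; rewrite leqnn.
by apply/allP=> u /(allP bd)/ltnW.
Qed.

Lemma word_inj : injective (@word n).
Proof. by move=> p q /eq_in_map eqpq; apply/permP=> x; apply: eqpq; rewrite mem_enum. Qed.

Lemma perm_word p : perm_eq (word p) (enum 'I_n).
Proof.
apply: uniq_perm; rewrite ?enum_uniq //.
  by rewrite /word codomE map_inj_uniq ?enum_uniq //; apply: perm_inj.
move=> x; rewrite mem_enum; apply/codomP; exists (p^-1%g x); by rewrite permKV.
Qed.

Lemma uniq_word p : uniq (word p).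
Proof. by rewrite (perm_uniq (perm_word p)) enum_uniq. Qed.

Lemma word_foata_cycles cs ds : canonical cs -> perm_eq (flatten cs) (enum 'I_n) ->
  perm_eq ds cs -> word (foata (cycles_perm ds)) = flatten cs.
Proof. by move=> ccs pcs pds; rewrite /foata (canonical_cycles_perm ccs) // of_wordK. Qed.

(** Every word is the flattening of a canonical list, so [foata] is onto; on a finite set this gives
    injectivity. *)
Lemma foata_inj : injective (@foata n).
Proof.
have surj q : exists p, foata p = q.
  have [cs ccs csq] := canonical_exists (uniq_word q).
  exists (cycles_perm cs); apply: word_inj.
  by rewrite (word_foata_cycles ccs) // csq perm_word.
suff /image_injP inj : #|image (@foata n) 'S_n| == #|'S_n|.
  by move=> p q; apply: inj.
rewrite eqn_leq leq_image_card; apply/subset_leq_card/subsetP=> q _.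
by have [p <-] := surj q; apply: image_f.
Qed.

Lemma cycles_perm_word_foata p :
  exists cs, [/\ canonical cs, flatten cs = word (foata p) & p = cycles_perm cs].
Proof.
have [cs ccs csq] := canonical_exists (uniq_word (foata p)).
exists cs; split=> //; apply/foata_inj/word_inj.
by rewrite (word_foata_cycles ccs) // csq perm_word.
Qed.

Lemma foata_fixed p x : (p x == x) = fixed_letter (word (foata p)) x.
Proof.
have [cs [ccs csw ->]] := cycles_perm_word_foata p.
have pcs : perm_eq (flatten cs) (enum 'I_n) by rewrite csw perm_word.
have ucs : uniq (flatten cs) by rewrite (perm_uniq pcs) enum_uniq.
rewrite (word_foata_cycles ccs pcs) // fixed_letter_canonical //.
by rewrite cycles_perm_fix // (perm_mem pcs) mem_enum.
Qed.

(** At an interior maximum [Phi_cycles] lists the cycle of [m] first while the canonical order puts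
    it last, hence equality only up to rearrangement. *)
Lemma canonical_Phi_cycles w : uniq w ->
  exists cs, [/\ canonical cs, perm_eq (Phi_cycles w) cs
                & flatten cs = lock_rev rix_locked w].
Proof.
elim/max_word_ind=> [|L m R uw bL bR [cs [ccs pcs fcs]] [ds [cds pds fds]]].
  exists [::]; split; first by constructor.
    by rewrite /Phi_cycles /Rix.
  by apply/esym/nilP; rewrite (nilp_perm (perm_lock_rev _ _)).
have [uL uR] := uniq_node uw.
rewrite (lock_rev_node rix_locking) //.
case: (boolP (nilp L)) => [/nilP L0|L0].
  subst L; exists [:: m :: rev R]; split; last by rewrite /= cats0.
    by apply: (@canonical_rcons [::]); rewrite ?below_rev //; constructor.
  by rewrite Phi_cycles_cons.
case: (boolP (nilp R)) => [/nilP R0|R0].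
  subst R; rewrite cats1 in uw *; exists (rcons cs [:: m]); split.
  - by constructor; rewrite // fcs (below_perm _ (perm_lock_rev _ uL)).
  - by rewrite Phi_cycles_rcons // -!cats1 perm_cat2r.
  - by rewrite flatten_rcons fcs cats1.
exists (rcons ds (m :: rev L)); split.
- by constructor; rewrite ?below_rev // fds (below_perm _ (perm_lock_rev _ uR)).
- by rewrite Phi_cycles_node // perm_sym perm_rcons perm_cons perm_sym.
- by rewrite flatten_rcons fds.
Qed.

Lemma word_foata_Phi p : word (foata (Phi p)) = lock_rev rix_locked (word p).
Proof.
have [cs [ccs pcs csE]] := canonical_Phi_cycles (uniq_word p).
rewrite -csE; apply: word_foata_cycles => //; rewrite csE.
exact: perm_trans (perm_lock_rev _ (uniq_word p)) (perm_word p).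
Qed.

(** * Orbits *)

Lemma mem_word p x : x \in word p.
Proof. by rewrite (perm_mem (perm_word p)) mem_enum. Qed.

Lemma word_hop x p : word (hop x p) = hop_in x (word p).
Proof.
have hE : hop_word x (word p) = hop_in x (word p) by rewrite /hop_in mem_word.
rewrite /hop hE of_wordK //.
exact: perm_trans (perm_hop_in x (uniq_word p)) (perm_word p).
Qed.

(** This treats all four orbits at once: [g] is the identity or [foata], and [F] gives the letters
    whose hops are suppressed. Since performed hops leave [F] unchanged, the suppressed letters are
    those of the initial word throughout. *)
Lemma word_comp_set (f : 'I_n -> 'S_n -> 'S_n) (g : 'S_n -> 'S_n)
    (F : seq 'I_n -> {set 'I_n}) p S :
  (forall x q, word (g (f x q)) =
     if x \in F (word (g q)) then word (g q) else hop_in x (word (g q))) ->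
  (forall w T, uniq w -> [disjoint T & F w] -> F (flip T w) = F w) ->
  word (g (comp_set f S p)) = flip (S :\: F (word (g p))) (word (g p)).
Proof.
move=> fE F_flip; rewrite /comp_set; set w := word (g p).
have uw : uniq w := uniq_word _.
(* The set is rewritten through its enumeration so that the induction can run over lists. *)
have -> : S :\: F w = [set x in enum S] :\: F w.
  by congr (_ :\: _); apply/setP=> x; rewrite inE mem_enum.
elim: (enum S) (enum_uniq S) => [_|x s IHs /andP[xs us]] /=.
  by rewrite -/w flip_off // => x _; rewrite !inE andbF.
have dis : [disjoint [set x in s] :\: F w & F w] by rewrite disjoints_subset setDE subsetIr.
rewrite fE IHs // F_flip //; case: ifP => xF.
  by apply: eq_flip => // y _; rewrite !inE; case: eqP => // ->; rewrite xF.
rewrite -flip_set1 flip_flip //; apply: eq_flip => // y _; rewrite !inE.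
by case: eqP => // ->; rewrite xF (negPf xs).
Qed.

Lemma word_hop_set S p : word (comp_set (@hop n) S p) = flip S (word p).
Proof.
rewrite (@word_comp_set _ id (fun=> set0)) ?setD0 // => x q.
by rewrite inE word_hop.
Qed.

Lemma foata_cyclic_hop x p : foata (cyclic_hop x p) = hop x (foata p).
Proof. by rewrite /cyclic_hop f_finv //; apply: foata_inj. Qed.

Lemma word_cyclic_hop_set S p :
  word (foata (comp_set (@cyclic_hop n) S p)) = flip S (word (foata p)).
Proof.
rewrite (@word_comp_set _ _ (fun=> set0)) ?setD0 // => x q.
by rewrite inE foata_cyclic_hop word_hop.
Qed.

Lemma word_restricted_hop_set S p :
  word (comp_set (@restricted_hop n) S p) = flip (S :\: rix_locked (word p)) (word p).
Proof.
rewrite (@word_comp_set _ id rix_locked) //.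
  by move=> x q; rewrite inE /restricted_hop; case: ifP; rewrite ?word_hop.
by move=> w T uw; apply: (locking_flip rix_locking).
Qed.

Lemma word_restricted_cyclic_hop_set S p :
  word (foata (comp_set (@restricted_cyclic_hop n) S p)) =
  flip (S :\: foata_locked (word (foata p))) (word (foata p)).
Proof.
rewrite (@word_comp_set _ _ foata_locked) //.
  move=> x q; rewrite inE -foata_fixed /restricted_cyclic_hop.
  by case: ifP; rewrite ?foata_cyclic_hop ?word_hop.
by move=> w T uw; apply: (locking_flip foata_locking).
Qed.

Lemma Phi_hop_orbit p :
  @Phi n @: hop_orbit (@hop n) p = hop_orbit (@cyclic_hop n) (Phi p).
Proof.
have uw := uniq_word p; have urw : uniq (rev (word p)) by rewrite rev_uniq.
apply/setP=> q; apply/imsetP/imsetP => [[_ /imsetP[S _ ->] ->]|[S _ ->]].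
  set w' := flip S (word p).
  (* theta(w') is rev(w) flipped at the locked letters of w' and at [S], and rev(w) is theta(w)
     flipped at the locked letters of w. *)
  exists (symdiff (symdiff (rix_locked w') S) (rix_locked (word p))) => //.
  apply/foata_inj/word_inj; rewrite word_cyclic_hop_set !word_foata_Phi word_hop_set.
  rewrite -/w' /lock_rev rev_flip // !flip_flip //.
  by apply: eq_flip => // x _; rewrite !inE -addbA addbb addbF.
set v := flip S (lock_rev rix_locked (word p)).
have uv : uniq v.
  have ul : uniq (lock_rev rix_locked (word p)).
    by rewrite (perm_uniq (perm_lock_rev _ uw)).
  by rewrite (perm_uniq (perm_flip _ ul)).
(* The preimage of [v] under theta is rev(v) flipped at [foata_locked v], and rev(v) is w flipped at
   its locked letters and at [S]. *)
exists (comp_set (@hop n) (symdiff (foata_locked v) (symdiff S (rix_locked (word p)))) p).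
  by apply/imsetP; eexists.
apply/foata_inj/word_inj; rewrite word_cyclic_hop_set !word_foata_Phi word_hop_set -/v.
rewrite -[LHS](lock_revK foata_locking rix_locking uv); congr lock_rev.
by rewrite /lock_rev {2}/v /lock_rev !flip_flip // rev_flip // revK flip_flip.
Qed.

(** The same [S] serves on both sides because theta preserves the set of locked letters and commutes
    with hops at the others. *)
Lemma Phi_restricted_hop_set S p :
  Phi (comp_set (@restricted_hop n) S p) = comp_set (@restricted_cyclic_hop n) S (Phi p).
Proof.
apply/foata_inj/word_inj.
rewrite word_restricted_cyclic_hop_set !word_foata_Phi word_restricted_hop_set.
rewrite (lock_rev_locking rix_locking foata_locking (uniq_word p)).
rewrite (lock_rev_flip rix_locking) ?uniq_word //.
by rewrite disjoints_subset setDE subsetIr.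
Qed.

End Hopping.

Theorem theorem25 (n : nat) (p : 'S_n) :
  @Phi n @: hop_orbit (@hop n) p = hop_orbit (@cyclic_hop n) (Phi p) /\
  @Phi n @: hop_orbit (@restricted_hop n) p = hop_orbit (@restricted_cyclic_hop n) (Phi p).
Proof.
split; first exact: Phi_hop_orbit.
rewrite /hop_orbit -imset_comp; apply: eq_imset => S /=.
exact: Phi_restricted_hop_set.
Qed.
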